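(* Let $h(x)=\sum_{k\ge1}h_kx^k\in\mathbb{K}[[x]]$ with $h_k\ne0$ for all $k\ge1$, let $y_0\in\mathbb{K}$, and let $G:(\mathbb{K}[[x]],d)\to(\mathbb{K}[[x]],d)$ be a non-expansive function. Then the initial value problem $\mathcal{D}_h(y)=G(y)$, $y(0)=y_0$, has a unique solution $y\in\mathbb{K}[[x]]$. This solution is the unique fixed point of $F:\mathbb{K}[[x]]\to\mathbb{K}[[x]]$ defined by $F(f)=y_0+(\mathcal{I}_h\circ G)(f)$.
   Context: $\mathbb{K}$ is a field of characteristic zero. On $\mathbb{K}[[x]]$, $\omega(s)$ denotes the order of a series (index of its first nonzero coefficient) and $d(f,g)=2^{-\omega(f-g)}$ (with $d(f,f)=0$). A function $G$ is non-expansive if $d(G(f),G(g))\le d(f,g)$ for all $f,g$. For $h$ as in the statement, the $h$-derivative is $\mathcal{D}_h\big(\sum_{k\ge0}s_kx^k\big)=\sum_{k\ge1}h_ks_kx^{k-1}$ and the $h$-integral is $\mathcal{I}_h\big(\sum_{k\ge0}s_kx^k\big)=\sum_{k\ge0}\frac{s_k}{h_{k+1}}x^{k+1}$. $y(0)$ denotes the constant term of $y$. *)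

(* Defs.v *)
From HB Require Import structures.
From mathcomp Require Import all_boot all_order all_algebra.
From mathcomp Require Import boolp classical_sets functions reals.

Set Implicit Arguments.
Unset Strict Implicit.
Unset Printing Implicit Defensive.

Import Order.TTheory GRing.Theory Num.Theory.
Local Open Scope ring_scope.

(* K[[x]]: s : fps K stands for \sum_k s_k x^k, with s_k written [s k].
   The additive structure is the pointwise one on functions. *)
Definition fps (K : fieldType) : Type := nat -> K.

HB.instance Definition _ (K : fieldType) :=
  GRing.Zmodule.copy (fps K) (nat -> K).

Definition fps_const (K : fieldType) (c : K) : fps K :=
  fun k => if k is 0%N then c else 0.

(* The value 0 on the zero series is a dummy, never used by [fps_dist]. *)
Definition fps_order (K : fieldType) (s : fps K) : nat :=
  if pselect (exists k, s k != 0) is left ex then ex_minn ex else 0%N.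

Definition fps_dist (R : realType) (K : fieldType) (f g : fps K) : R :=
  if f == g then 0 else 2 ^- fps_order (f - g).

Definition nonexpansive (R : realType) (K : fieldType)
    (G : fps K -> fps K) : Prop :=
  forall f g : fps K, fps_dist R (G f) (G g) <= fps_dist R f g.

(* \sum_(k >= 1) h_k s_k x^(k-1), reindexed by k := k + 1. *)
Definition hderiv (K : fieldType) (h s : fps K) : fps K :=
  fun k => h k.+1 * s k.+1.

(* \sum_(k >= 0) (s_k / h_(k+1)) x^(k+1). *)
Definition hint (K : fieldType) (h s : fps K) : fps K :=
  fun k => if k is j.+1 then s j / h j.+1 else 0.

(* Main.v *)
(* In terms of coefficients, non-expansiveness says that the first n
   coefficients of G f depend only on the first n coefficients of f.  The
   integral shifts indices by one, so the first n + 1 coefficients of F f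
   depend only on the first n of f: iterating F from any series stabilises
   coefficientwise, and two fixed points agree to every order.  The initial
   value problem and the fixed point equation are the same coefficientwise. *)
Require Import Defs.
From mathcomp Require Import all_boot all_order all_algebra.
From mathcomp Require Import boolp classical_sets functions reals.
Import Order.TTheory GRing.Theory Num.Theory.
Local Open Scope ring_scope.

(** This is the closed ball relation of radius 2^-n, put without the metric so that equal series
    need no separate case. *)
Definition fps_agree {K : fieldType} (n : nat) (f g : fps K) : Prop :=
  forall k, (k < n)%N -> f k = g k.

Lemma fps_order_geP {K : fieldType} (f g : fps K) (n : nat) :
  f != g -> (n <= fps_order (f - g)%R)%N <-> fps_agree n f g.
Proof.
move=> fg; rewrite /fps_order; case: pselect => [ex|nex]; last first.
  case/eqP: fg; apply/funext => k; apply/eqP; rewrite -subr_eq0.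
  by apply/negPn/negP => fgk; apply: nex; exists k.
case: ex_minnP => m mP m_min; split=> [nm k kn|agr].
  apply/eqP; rewrite -subr_eq0; apply/negPn/negP => fgk.
  by have := leq_trans kn (leq_trans nm (m_min k fgk)); rewrite ltnn.
rewrite leqNgt; apply/negP => /agr fgm.
by move: mP; rewrite -[(f - g) m]/(f m - g m) fgm subrr eqxx.
Qed.

Lemma fps_dist_leP (R : realType) {K : fieldType} (f g : fps K) (n : nat) :
  fps_dist R f g <= 2 ^- n <-> fps_agree n f g.
Proof.
rewrite /fps_dist; case: eqP => [->|/eqP fg].
  by split=> // _; rewrite invr_ge0 exprn_ge0.
rewrite -(fps_order_geP _ _ _ fg) lef_pV2 ?posrE ?exprn_gt0 //.
by rewrite ler_eXn2l ?ltr1n.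
Qed.

Lemma nonexpansive_agree (R : realType) {K : fieldType} (G : fps K -> fps K) :
  nonexpansive R G ->
  forall n f g, fps_agree n f g -> fps_agree n (G f) (G g).
Proof.
move=> G_ne n f g /(fps_dist_leP R) fg; apply/(fps_dist_leP R).
exact: le_trans (G_ne f g) fg.
Qed.

(** Banach's theorem for contraction factor 1/2, with the limit of the iterates written down
    explicitly. *)
Lemma fps_contraction_fixpoint {K : fieldType} (F : fps K -> fps K) :
  (forall n f g, fps_agree n f g -> fps_agree n.+1 (F f) (F g)) ->
  exists y, unique (fun f => F f = f) y.
Proof.
move=> F_contr; pose u n := iter n F (0 : fps K).
have uD n m : fps_agree n (u n) (u (n + m)%N).
  by elim: n => [//|n IHn]; rewrite addSn; apply: F_contr.
(* By [uD], coefficient k is stable from iterate k + 1 on. *)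
pose y : fps K := fun k => u k.+1 k.
have uy n : fps_agree n (u n) y.
  by move=> k kn; rewrite /y -(subnKC kn) -uD.
exists y; split=> [|z Fz]; apply/funext => k.
  (* Coefficient k of [F y] is that of [F (u k)], which is [u k.+1] by definition. *)
  by rewrite -(F_contr _ _ _ (uy k) k (ltnSn k)).
have uz n : fps_agree n (u n) z.
  by elim: n => [//|n IHn]; rewrite -Fz; apply: F_contr.
exact: uz.
Qed.

(** The series [g] stands for [G z]. As [hint] has zero constant term, coefficient 0 carries the
    initial value alone; in degree k + 1 one divides or multiplies by [h k.+1]. *)
Lemma hderiv_hint_eqP {K : fieldType} (h g z : fps K) (y0 : K) :
  (forall k, (1 <= k)%N -> h k != 0) ->
  hderiv h z = g /\ z 0%N = y0 <-> fps_const y0 + hint h g = z.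
Proof.
move=> h_neq0; split=> [[<- <-]|<-].
  apply/funext => -[|k]; first exact: addr0.
  by apply: etrans (add0r _) _; rewrite /hint /hderiv mulrC mulKf ?h_neq0.
split; last exact: addr0.
apply/funext => k; rewrite /hderiv -[(_ + _) k.+1]/(0 + g k / h k.+1).
by rewrite add0r mulrC divfK ?h_neq0.
Qed.

Theorem mainTheorem2 (R : realType) (K : fieldType)
  (charK0 : [pchar K] =i pred0)
  (h : fps K) (h0 : h 0%N = 0) (h_neq0 : forall k : nat, (1 <= k)%N -> h k != 0)
  (y0 : K) (G : fps K -> fps K) (G_nonexp : nonexpansive R G) :
  let F : fps K -> fps K := fun f => fps_const y0 + hint h (G f) in
  exists y : fps K,
    unique (fun z : fps K => hderiv h z = G z /\ z 0%N = y0) y /\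
    unique (fun f : fps K => F f = f) y.
Proof.
move=> F; have F_contr n f g : fps_agree n f g -> fps_agree n.+1 (F f) (F g).
  (* Coefficient 0 of [F f] does not depend on [f]; coefficient k + 1 uses only coefficient k of
     [G f]. *)
  move=> /(nonexpansive_agree R G G_nonexp) GfG [//|k] kn.
  by congr (_ + _ / _); apply: GfG.
have [y [Fy y_uniq]] := fps_contraction_fixpoint F F_contr.
exists y; split; last by split.
split=> [|z /hderiv_hint_eqP]; first exact/hderiv_hint_eqP.
by move=> /(_ h_neq0); exact: y_uniq.
Qed.
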